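(* Every locally solvable subgroup of $PLo(I)$ is countable.
   Context: $PLo(I)$ denotes the group (under composition) of piecewise linear orientation-preserving homeomorphisms of the unit interval $I=[0,1]$ having only finitely many points of non-differentiability (breakpoints). A group is locally solvable if every finitely generated subgroup of it is solvable. Countable means finite or countably infinite. *)

(* Defs.v *)
From HB Require Import structures.
From mathcomp Require Import all_boot all_order all_algebra.
From mathcomp Require Import all_classical all_reals all_analysis.
From mathcomp Require Import ring lra.

Set Implicit Arguments.
Unset Strict Implicit.
Unset Printing Implicit Defensive.

Import Order.TTheory GRing.Theory Num.Theory.
Import numFieldNormedType.Exports.

Local Open Scope classical_set_scope.
Local Open Scope ring_scope.

Section PLHomeomorphisms.
Variable R : realType.

Definition unit_itv : set R := `[0, 1]%classic.

(* The extension by 0 to the real line is only a device for differentiating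
   f at points of the open interval, where its value outside I is irrelevant. *)
Definition ext (f : unit_itv -> unit_itv) : R -> R :=
  valL_ 0 (fun x => val (f x)).

Definition breakpoints (f : unit_itv -> unit_itv) : set R :=
  [set x | 0 < x < 1 /\ ~ derivable (ext f) x 1].

Definition affine_on (a b : R) (f : unit_itv -> unit_itv) : Prop :=
  exists m c : R, forall x : unit_itv, a <= val x <= b ->
    val (f x) = m * val x + c.

Definition piecewise_linear (f : unit_itv -> unit_itv) : Prop :=
  finite_set (breakpoints f) /\
  forall a b : R, 0 <= a -> a < b -> b <= 1 ->
    (forall x, a < x < b -> ~ breakpoints f x) -> affine_on a b f.

Definition homeomorphism (f : unit_itv -> unit_itv) : Prop :=
  continuous f /\
  exists g : unit_itv -> unit_itv, [/\ continuous g, cancel f g & cancel g f].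

Definition orientation_preserving (f : unit_itv -> unit_itv) : Prop :=
  forall x y : unit_itv, val x < val y -> val (f x) < val (f y).

Record PLo := MkPLo {
  PLo_fun :> unit_itv -> unit_itv;
  PLo_homeo : homeomorphism PLo_fun;
  PLo_incr : orientation_preserving PLo_fun;
  PLo_pl : piecewise_linear PLo_fun }.

Lemma PLo_ext (f g : PLo) : (forall x, f x = g x) -> f = g.
Proof.
case: f g => [f hf incf plf] [g hg incg plg] /= /funext efg; subst g.
by congr MkPLo; exact: Prop_irrelevance.
Qed.

Lemma extE f (x : unit_itv) : ext f (val x) = val (f x).
Proof. by rewrite /ext /= oinv_set_val valK. Qed.

Lemma unit_itvP (x : unit_itv) : 0 <= val x <= 1.
Proof. by have := set_valP x; rewrite /unit_itv /= in_itv. Qed.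

Lemma to_unit_itv (x : R) : 0 <= x <= 1 -> exists u : unit_itv, val u = x.
Proof.
move=> hx; have ux : x \in unit_itv by rewrite inE /unit_itv /= in_itv.
by exists (exist _ x ux).
Qed.

Lemma avoid_nbhd (s : seq R) (x : R) : 0 < x < 1 -> x \notin s ->
  exists a b : R, [/\ 0 <= a, a < x, x < b, b <= 1 &
    forall y, a < y < b -> y \notin s].
Proof.
move=> x01; elim: s => [_|p s IHs]; first by exists 0, 1; split => //; lra.
rewrite inE negb_or => /andP[xp /IHs[a [b [a0 ax xb b1 hs]]]].
case: (ltgtP x p) => [ltxp|ltpx|exp]; last by rewrite exp eqxx in xp.
- exists a, (Num.min b p); split=> //; first by rewrite lt_min xb ltxp.
    by rewrite ge_min b1.
  move=> y; rewrite lt_min => /and3P[ay yb yp].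
  by rewrite inE negb_or lt_eqF //= hs // ay.
- exists (Num.max a p), b; split=> //.
  + by rewrite le_max a0.
  + by rewrite gt_max ax.
  move=> y; rewrite gt_max => /andP[/andP[ay py] yb].
  by rewrite inE negb_or gt_eqF //= hs // ay.
Qed.

Lemma affine_derivable f (a b x : R) : 0 <= a -> a < x -> x < b -> b <= 1 ->
  affine_on a b f -> derivable (ext f) x 1.
Proof.
move=> a0 ax xb b1 [m [c fE]].
apply: (@near_eq_derivable _ _ _ (fun t : R => m * t + c)); last first.
  by apply: derivableD => //; apply: derivableM.
near=> t.
have at_ : a < t by near: t; exact: lt_nbhsr.
have tb : t < b by near: t; exact: lt_nbhsl.
have t01 : 0 <= t <= 1.
  by rewrite (le_trans a0 (ltW at_)) (le_trans (ltW tb) b1).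
have [u eu] := to_unit_itv t01.
by rewrite -eu extE fE // eu !ltW.
Unshelve. all: by end_near.
Qed.

Lemma affine_glue f (a p b : R) : 0 <= a -> a < p -> p < b -> b <= 1 ->
  derivable (ext f) p 1 -> affine_on a p f -> affine_on p b f ->
  affine_on a b f.
Proof.
move=> a0 ap pb b1 df [m1 [c1 f1]] [m2 [c2 f2]].
have [P eP] : exists u : unit_itv, val u = p by apply: to_unit_itv; lra.
have fp1 := f1 P; have fp2 := f2 P; rewrite eP in fp1 fp2.
have {}fp1 := fp1 ltac:(lra); have {}fp2 := fp2 ltac:(lra).
suff em : m1 = m2.
  exists m1, c1 => x abx; case: (leP (val x) p) => xp; first by apply: f1; lra.
  by rewrite f2; last lra; have : c1 = c2 by [rewrite em in fp1; lra]; rewrite em => ->.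
apply: contrapT => /eqP nm.
have e0 : 0 < `|m1 - m2| / 2 by rewrite divr_gt0 // normr_gt0 subr_eq0.
move: df => /cvg_ex[l /cvgr_dist_lt /(_ _ e0)].
move=> /nbhs_ballP[d /= d0 hd].
pose h := Num.min (d / 2) (Num.min (p - a) (b - p)).
have h0 : 0 < h by rewrite !lt_min; apply/and3P; split; lra.
have hdlt : h < d by rewrite gt_min; apply/orP; left; lra.
have hpa : h <= p - a by rewrite !ge_min lexx orbT.
have hpb : h <= b - p by rewrite !ge_min lexx !orbT.
have := hd h; have := hd (- h).
rewrite /ball /= !sub0r opprK normrN gtr0_norm // oppr_eq0 gt_eqF // => hm hp.
have {}hm := hm hdlt isT; have {}hp := hp hdlt isT.
have [um eum] : exists u : unit_itv, val u = - h + p by apply: to_unit_itv; lra.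
have [up eup] : exists u : unit_itv, val u = h + p by apply: to_unit_itv; lra.
have Em : ext f ((- h) *: 1 + p) - ext f p = m1 * (- h).
  rewrite [X in ext f (X + p)]mulr1 -eum -eP !extE f1 ?fp1 eum; lra.
have Ep : ext f (h *: 1 + p) - ext f p = m2 * h.
  rewrite [X in ext f (X + p)]mulr1 -eup -eP !extE f2 ?fp2 eup; lra.
have h_neq0 : h != 0 by rewrite gt_eqF.
rewrite Em in hm; rewrite Ep in hp.
have q1 : (- h)^-1 *: (m1 * (- h)) = m1.
  by rewrite /GRing.scale /= mulrCA mulVf ?mulr1 // oppr_eq0.
have q2 : h^-1 *: (m2 * h) = m2 by rewrite /GRing.scale /= mulrCA mulVf ?mulr1.
rewrite q1 in hm; rewrite q2 in hp.
have := ler_distD l m1 m2; rewrite (distrC m1 l); lra.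
Qed.

Lemma piecewise_linearP f : piecewise_linear f <->
  exists2 B : set R, finite_set B &
  forall a b : R, 0 <= a -> a < b -> b <= 1 ->
    (forall x, a < x < b -> ~ B x) -> affine_on a b f.
Proof.
split=> [[finB hB]|[B /finite_seqP[s Bs] hB]]; first by exists (breakpoints f).
have hs a b : 0 <= a -> a < b -> b <= 1 ->
    (forall x, a < x < b -> x \notin s) -> affine_on a b f.
  move=> a0 ab b1 h; apply: hB => // x /h; rewrite Bs /=.
  by move/negP.
split.
  apply: (@sub_finite_set _ _ [set` s]) => [x [x01 nd]|]; last exact: finite_seq.
  rewrite /=; apply: contrapT => /negP xs.
  have [a [b [a0 ax xb b1 h]]] := avoid_nbhd x01 xs.
  apply: nd; apply: (affine_derivable a0 ax xb b1); apply: hs => //.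
  exact: lt_trans xb.
suff hs0 : forall a b : R, 0 <= a -> a < b -> b <= 1 ->
  (forall x, a < x < b -> ~ breakpoints f x /\ x \notin [::]) -> affine_on a b f.
  by move=> a b a0 ab b1 h; apply: hs0 => // x /h.
have {hs} : forall a b : R, 0 <= a -> a < b -> b <= 1 ->
  (forall x, a < x < b -> ~ breakpoints f x /\ x \notin s) -> affine_on a b f.
  by move=> a b a0 ab b1 h; apply: hs => // x /h[].
elim: s {Bs hB} => [//|p s IHs hs]; apply: IHs => a b a0 ab b1 h.
have [/andP[ap pb]|apb] := boolP (a < p < b).
  apply: (affine_glue a0 ap pb b1).
  - have [nb _] := h p (introT andP (conj ap pb)).
    by apply: contrapT => nd; apply: nb; split => //; lra.
  - apply: hs => // [|x /andP[ax xp]]; first lra.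
    have [|nb xs] := h x; first by lra.
    by rewrite inE negb_or xs lt_eqF.
  - apply: hs => // [|x /andP[ax xp]]; first lra.
    have [|nb xs] := h x; first by lra.
    by rewrite inE negb_or xs gt_eqF.
apply: hs => // x axb; have [nb xs] := h x axb.
split => //; rewrite inE negb_or xs andbT.
by apply: contraNneq apb => <-.
Qed.

Lemma homeomorphism_id : homeomorphism idfun.
Proof. by split; [move=> x; exact: cvg_id|exists idfun; split=> // x; exact: cvg_id]. Qed.

Lemma piecewise_linear_id : piecewise_linear idfun.
Proof.
by apply/piecewise_linearP; exists set0 => // a b _ _ _ _; exists 1, 0 => x _ /=; ring.
Qed.

Definition PLo_one : PLo :=
  @MkPLo idfun homeomorphism_id (fun x y xy => xy) piecewise_linear_id.

Lemma homeomorphism_comp f g :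
  homeomorphism f -> homeomorphism g -> homeomorphism (f \o g).
Proof.
move=> [cf [f' [cf' fK f'K]]] [cg [g' [cg' gK g'K]]]; split.
  by move=> x; apply: continuous_comp; [exact: cg|exact: cf].
exists (g' \o f'); split; [|exact: can_comp|exact: can_comp].
by move=> x; apply: continuous_comp; [exact: cf'|exact: cg'].
Qed.

Lemma orientation_le f : orientation_preserving f ->
  forall x y : unit_itv, (val x <= val y) = (val (f x) <= val (f y)).
Proof.
move=> incf x y; apply/idP/idP; last first.
  by apply: contraTT; rewrite -!ltNge; exact: incf.
by rewrite le_eqVlt => /orP[/eqP/val_inj->//|/incf/ltW].
Qed.

Lemma piecewise_linear_comp (f g : PLo) : piecewise_linear (f \o g).
Proof.
have /piecewise_linearP[A finA hA] := PLo_pl f.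
have /piecewise_linearP[B finB hB] := PLo_pl g.
have [_ [g' [_ gK g'K]]] := PLo_homeo g.
apply/piecewise_linearP; exists (B `|` ext g' @` A).
  by rewrite finite_setU; split => //; exact: finite_image.
move=> a b a0 ab b1 h.
have [u eu] : exists u : unit_itv, val u = a by apply: to_unit_itv; lra.
have [v ev] : exists v : unit_itv, val v = b by apply: to_unit_itv; lra.
have [|m [c gE]] := hB a b a0 ab b1.
  by move=> x axb Bx; apply: (h x axb); left.
have lE := orientation_le (PLo_incr g).
have gu := unit_itvP (g u); have gv := unit_itvP (g v).
have guv : val (g u) < val (g v) by apply: (PLo_incr g); rewrite eu ev.
have [||| |n [d fE]] := hA (val (g u)) (val (g v)); [lra|by []|lra| |].
  move=> y yuv Ay.
  have [w ew] : exists w : unit_itv, val w = y by apply: to_unit_itv; lra.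
  move: yuv; rewrite -ew -(g'K w) !ltNge -!lE -!ltNge eu ev => /h; apply.
  by right; exists y => //; rewrite -ew extE.
exists (n * m), (n * c + d) => x axb /=.
rewrite fE; last by rewrite -!lE eu ev.
by rewrite gE // mulrDr mulrA addrA.
Qed.

Definition PLo_mul (f g : PLo) : PLo :=
  @MkPLo (f \o g) (homeomorphism_comp (PLo_homeo f) (PLo_homeo g))
    (fun x y xy => PLo_incr f (PLo_incr g xy)) (piecewise_linear_comp f g).

Lemma PLo_has_inv (f : PLo) : exists g : PLo, cancel f g /\ cancel g f.
Proof.
have [cf [g [cg fK gK]]] := PLo_homeo f.
have lf := orientation_le (PLo_incr f).
have incg : orientation_preserving g.
  by move=> x y; rewrite -{1}(gK x) -{1}(gK y) !ltNge -lf.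
have lg := orientation_le incg.
suff plg : piecewise_linear g.
  by exists (@MkPLo g (conj cg (ex_intro _ _ (And3 cf gK fK))) incg plg).
have /piecewise_linearP[A finA hA] := PLo_pl f.
apply/piecewise_linearP; exists (ext f @` A); first exact: finite_image.
move=> a b a0 ab b1 h.
have [u eu] : exists u : unit_itv, val u = a by apply: to_unit_itv; lra.
have [v ev] : exists v : unit_itv, val v = b by apply: to_unit_itv; lra.
have guv : val (g u) < val (g v) by apply: incg; rewrite eu ev.
have gu := unit_itvP (g u); have gv := unit_itvP (g v).
have [||| |m [c fE]] := hA (val (g u)) (val (g v)); [lra|by []|lra| |].
  move=> y yuv Ay.
  have [w ew] : exists w : unit_itv, val w = y by apply: to_unit_itv; lra.
  apply: (h (val (f w))); last by exists y => //; rewrite -ew extE.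
  by rewrite -eu -ev -(gK u) -(gK v) !ltNge -!lf -!ltNge ew.
have fgE x : a <= val x <= b -> val x = m * val (g x) + c.
  by move=> xab; rewrite -fE ?gK // -!lg eu ev.
have m0 : m != 0.
  apply/eqP => m0; have := fgE u; have := fgE v; rewrite m0 eu ev; lra.
exists m^-1, (- (m^-1 * c)) => x /fgE ->.
by rewrite mulrDr mulrA mulVf // mul1r addrK.
Qed.

Definition PLo_inv (f : PLo) : PLo := projT1 (cid (PLo_has_inv f)).

HB.instance Definition _ := gen_eqMixin PLo.
HB.instance Definition _ := gen_choiceMixin PLo.

Lemma PLo_mulA : associative PLo_mul.
Proof. by move=> f g h; apply: PLo_ext. Qed.

Lemma PLo_mul1 : left_id PLo_one PLo_mul.
Proof. by move=> f; apply: PLo_ext. Qed.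

Lemma PLo_mulr1 : right_id PLo_one PLo_mul.
Proof. by move=> f; apply: PLo_ext. Qed.

Lemma PLo_mulV : left_inverse PLo_one PLo_inv PLo_mul.
Proof.
move=> f; apply: PLo_ext => x /=; rewrite /PLo_inv.
by case: cid => g /= [fK _]; exact: fK.
Qed.

Lemma PLo_mulrV : right_inverse PLo_one PLo_inv PLo_mul.
Proof.
move=> f; apply: PLo_ext => x /=; rewrite /PLo_inv.
by case: cid => g /= [_ gK]; exact: gK.
Qed.

HB.instance Definition _ :=
  isGroup.Build PLo PLo_mulA PLo_mul1 PLo_mulr1 PLo_mulV PLo_mulrV.

End PLHomeomorphisms.

Section LocallySolvable.
Variable G : groupType.
Implicit Types H K X : set G.
Local Open Scope group_scope.

Definition subgroup H : Prop := group_closed (mem H).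

Definition generated X : set G := smallest subgroup X.

Definition finitely_generated K : Prop :=
  exists2 X, finite_set X & K = generated X.

Definition derived_subgroup H : set G :=
  generated [set z | exists x y, [/\ H x, H y & z = [~ x, y]]].

Definition derived_series (n : nat) H : set G := iter n derived_subgroup H.

Definition solvable H : Prop := exists n, derived_series n H = [set 1].

Definition locally_solvable H : Prop :=
  forall K, finitely_generated K -> K `<=` H -> solvable K.

End LocallySolvable.

(* Main.v *)
(* Extend every element of PLo(I) by the identity to an action on the real line.
   An orbital of [g] is a component of its support.
   (1) In a finitely generated solvable group, two orbitals that meet are equal or
   one contains the closure of the other.  Otherwise the commutators have no
   common fixed point in some component (p, q) of the support of the group, while
   each of them is the identity near p, because affine germs fixing p commute.
   These two properties pass to all further derived subgroups.
   (2) Hence a locally solvable H has countably many orbitals: if g has orbital B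
   and moves q up, then no smaller orbital containing q contains a point of B
   above g(q), so B is determined by q and such a point, both rational.
   (3) Endpoints of orbitals form a countable invariant set E.  An affine piece of
   an element of H whose domain contains two points of E is determined by their
   images.  On an interval without points of E, either no element of H moves a
   point to a nearby one, or the interval lies in a minimal orbital, where the
   stabilizer acts freely and discretely.  So H has countably many affine pieces,
   and breakpoints are crossings of such pieces. *)
Require Import Defs.
From mathcomp Require Import all_boot all_classical all_reals.
From mathcomp Require Import all_order all_algebra.
From mathcomp Require Import lra.

Set Implicit Arguments.
Unset Strict Implicit.
Unset Printing Implicit Defensive.

Import Order.TTheory GRing.Theory Num.Theory.
Local Open Scope classical_set_scope.
Local Open Scope ring_scope.

(** * Subgroups, generation and derived subgroups *)

Section Subgroups.
Variable G : groupType.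
Implicit Types (H K X : set G) (x y : G).

Lemma subgroupP H :
  subgroup H <-> H 1%g /\ forall x y, H x -> H y -> H (x * y^-1)%g.
Proof.
split=> [[]|[H1 HV]]; last first.
  by split=> [|x y]; rewrite !in_setE //; exact: HV.
rewrite in_setE => H1 HV; split=> // x y Hx Hy.
by have := HV x y; rewrite !in_setE; exact.
Qed.

Lemma subgroup1 H : subgroup H -> H 1%g.
Proof. by move=> /subgroupP[]. Qed.

Lemma subgroupV H x : subgroup H -> H x -> H x^-1%g.
Proof. by move=> /subgroupP[H1 HV] Hx; rewrite -[x^-1%g]mul1g; exact: HV. Qed.

Lemma subgroupM H x y : subgroup H -> H x -> H y -> H (x * y)%g.
Proof.
move=> sH Hx Hy; rewrite -[y]invgK; have /subgroupP[_] := sH; apply=> //.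
exact: subgroupV.
Qed.

Lemma subgroup_comm H x y : subgroup H -> H x -> H y -> H [~ x, y]%g.
Proof.
move=> sH Hx Hy; rewrite /commg /conjg.
by do ! [apply: subgroupM => // | apply: subgroupV => //].
Qed.

Lemma generated_subgroup X : subgroup (generated X).
Proof.
apply/subgroupP; split=> [K [/subgroup1]//|x y Xx Xy K KX].
by have [/subgroupP[_ KV] _] := KX; apply: KV; [exact: Xx|exact: Xy].
Qed.

Lemma sub_generated X x : X x -> generated X x.
Proof. by move=> Xx K [_]; exact. Qed.

Lemma generated_sub X K : subgroup K -> X `<=` K -> generated X `<=` K.
Proof. by move=> sK XK x; apply. Qed.

Lemma derived_comm K x y : K x -> K y -> derived_subgroup K [~ x, y]%g.
Proof. by move=> Kx Ky; apply: sub_generated; exists x, y. Qed.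

Lemma derived_sub K L : subgroup L -> (forall x y, K x -> K y -> L [~ x, y]%g) ->
  derived_subgroup K `<=` L.
Proof.
by move=> sL KL; apply: generated_sub => // z [x [y [Kx Ky ->]]]; exact: KL.
Qed.

Lemma derived_subgroup_sub K : subgroup K -> derived_subgroup K `<=` K.
Proof. by move=> sK; apply: derived_sub => // x y; exact: subgroup_comm. Qed.

Lemma derived_seriesSr n K :
  derived_series n.+1 K = derived_series n (derived_subgroup K).
Proof. exact: iterSr. Qed.

End Subgroups.

(* The trivial region is symmetric about 0 so that [x |-> - x] turns such an action
   into another one: statements at left ends of orbitals then give those at right
   ends. *)
Record pl_action (G : groupType) (R : realType) (act : G -> R -> R) : Prop :=
  PLAction {
    act1 : forall x, act 1%g x = x;
    actM : forall g h x, act (g * h)%g x = act g (act h x);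
    act_incr : forall g x y, x < y -> act g x < act g y;
    act_out : forall g x, 1 <= `|x| -> act g x = x;
    act_pl : forall g, exists s : seq R, forall a b, a < b ->
      (forall x, a < x < b -> x \notin s) ->
      exists m c, forall x, a <= x <= b -> act g x = m * x + c }.

Definition mirror (G : groupType) (R : realType) (act : G -> R -> R) g x :=
  - act g (- x).

Lemma mirror_pl_action (G : groupType) (R : realType) (act : G -> R -> R) :
  pl_action act -> pl_action (mirror act).
Proof.
move=> A; rewrite /mirror; split.
- by move=> x; rewrite (act1 A) opprK.
- by move=> g h x; rewrite (actM A) opprK.
- by move=> g x y xy; rewrite ltrN2; apply: (act_incr A); rewrite ltrN2.
- by move=> g x x1; rewrite (act_out A) ?opprK ?normrN.
move=> g; have [s hs] := act_pl A g; exists [seq - x | x <- s] => a b ab gap.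
have [||m [c hc]] := hs (- b) (- a); first by rewrite ltrN2.
  move=> x /andP[bx xa]; apply: contra (_ : - x \notin [seq - x | x <- s]).
    by move=> xs; apply/mapP; exists x.
  by apply: gap; lra.
exists m, (- c) => x xab; rewrite hc; lra.
Qed.

Definition fixed_by (G : groupType) (R : realType) (act : G -> R -> R)
  (K : set G) (x : R) := forall k, K k -> act k x = x.

(** Pointwise form of the condition that the derived subgroup of [K] fixes [x]. *)
Definition commuting_at (G : groupType) (R : realType) (act : G -> R -> R)
    (K : set G) (x : R) :=
  forall k l, K k -> K l -> act k (act l x) = act l (act k x).

Definition orbital (G : groupType) (R : realType) (act : G -> R -> R) g (a b : R) :=
  [/\ a < b, act g a = a, act g b = b & forall x, a < x < b -> act g x <> x].

(** * Fixed points, germs at fixed points, and solvability *)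

Section Dynamics.
Variables (G : groupType) (R : realType) (act : G -> R -> R).
Hypothesis A : pl_action act.
Implicit Types (g h k : G) (K H : set G) (x y p q r a b : R).

Lemma actK g x : act g^-1%g (act g x) = x.
Proof. by rewrite -(actM A) mulVg (act1 A). Qed.

Lemma actKV g x : act g (act g^-1%g x) = x.
Proof. by rewrite -(actM A) mulgV (act1 A). Qed.

Lemma act_ltE g x y : (act g x < act g y) = (x < y).
Proof.
apply/idP/idP; last exact: (act_incr A).
by move=> /(act_incr A g^-1%g); rewrite !actK.
Qed.

Lemma act_leE g x y : (act g x <= act g y) = (x <= y).
Proof. by rewrite !leNgt act_ltE. Qed.

Lemma act_inj g : injective (act g).
Proof. by move=> x y e; rewrite -(actK g x) e actK. Qed.

Lemma act_fixV g x : act g x = x -> act g^-1%g x = x.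
Proof. by move=> e; rewrite -{1}e actK. Qed.

Lemma act_comm_fix g h x : act g (act h x) = act h (act g x) ->
  act [~ g, h]%g x = x.
Proof. by move=> e; rewrite /commg /conjg !(actM A) e !actK. Qed.

Lemma comm_fix_act g h x : act [~ g, h]%g x = x ->
  act g (act h x) = act h (act g x).
Proof. by rewrite /commg /conjg !(actM A) => {2}<-; rewrite !actKV. Qed.

Lemma stab_subgroup x : subgroup [set g | act g x = x].
Proof.
apply/subgroupP; split=> [|g h /= gx hx]; first exact: (act1 A).
by rewrite (actM A) act_fixV.
Qed.

Lemma act_sup g (S : set R) : S !=set0 -> has_ubound S ->
  (forall x, S x -> S (act g x)) -> (forall x, S x -> S (act g^-1%g x)) ->
  act g (sup S) = sup S.
Proof.
move=> S0 Sb Sg SV; apply/eqP; rewrite eq_le; apply/andP; split.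
  rewrite -(act_leE g^-1%g) actK; apply: ge_sup => // x Sx.
  by rewrite -(act_leE g) actKV; apply: ub_le_sup => //; exact: Sg.
apply: ge_sup => // x Sx; rewrite -(actKV g x) act_leE.
by apply: ub_le_sup => //; exact: SV.
Qed.

Lemma act_inf g (S : set R) : S !=set0 -> has_lbound S ->
  (forall x, S x -> S (act g x)) -> (forall x, S x -> S (act g^-1%g x)) ->
  act g (inf S) = inf S.
Proof.
move=> S0 Sb Sg SV; apply/eqP; rewrite eq_le; apply/andP; split.
  apply: lb_le_inf => // x Sx; rewrite -(actKV g x) act_leE.
  by apply: ge_inf => //; exact: SV.
rewrite -(act_leE g^-1%g) actK; apply: lb_le_inf => // x Sx.
by rewrite -(act_leE g) actKV; apply: ge_inf => //; exact: Sg.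
Qed.

(** The infimum of the orbit of [x] is fixed by [K] and lies between [p] and [x], so it is [p]. *)
Lemma orbit_near_left K p q x e : subgroup K -> fixed_by act K p ->
  (forall y, p < y < q -> ~ fixed_by act K y) -> p < x < q -> p < e ->
  exists2 k, K k & p < act k x < e.
Proof.
move=> sK Kp nK /andP[px xq] pe.
pose S := [set act k x | k in K].
have S0 : S !=set0 by exists x, 1%g; [exact: subgroup1|exact: (act1 A)].
have Sp y : S y -> p < y by move=> [k Kk <-]; rewrite -(Kp k Kk) act_ltE.
have Sb : has_lbound S by exists p => y /Sp/ltW.
have pinf : p <= inf S by apply: lb_le_inf => // y /Sp/ltW.
have infx : inf S <= x.
  by apply: ge_inf => //; exists 1%g; [exact: subgroup1|exact: (act1 A)].
have infp : inf S = p.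
  apply/eqP; rewrite eq_le pinf andbT leNgt; apply/negP => pi.
  apply: (nK (inf S)); first by rewrite pi (le_lt_trans infx).
  move=> k Kk; apply: act_inf => // y [l Kl <-].
    by exists (k * l)%g; [exact: subgroupM|rewrite (actM A)].
  exists (k^-1 * l)%g; last by rewrite (actM A).
  by apply: subgroupM => //; exact: subgroupV.
have [|y [k Kk <-] ye] := @inf_lt _ S e S0; first by rewrite infp.
by exists k => //; rewrite ye andbT; apply: Sp; exists k.
Qed.

(* Elements agreeing with the identity near [p] are preserved by passing to the
   derived subgroup, and so is the absence of fixed points: a point fixed by all
   commutators has an orbit accumulating at [p], where every element is trivial. *)
Lemma derived_no_fixed K p q : subgroup K -> fixed_by act K p ->
  (forall y, p < y < q -> ~ fixed_by act K y) ->
  (forall k, K k -> exists2 e, p < e & forall y, p < y < e -> act k y = y) ->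
  forall y, p < y < q -> ~ fixed_by act (derived_subgroup K) y.
Proof.
move=> sK Kp nK triv y ypq fy; apply: (nK y ypq) => k Kk.
have [e pe ke] := triv k Kk.
have [l Kl /ke lye] := orbit_near_left sK Kp nK ypq pe.
apply: (@act_inj l); rewrite -[RHS]lye.
by symmetry; apply: comm_fix_act; apply: fy; exact: derived_comm.
Qed.

(** All hypotheses pass to the derived subgroup, hence along the derived series, whereas the trivial
    group fixes every point of [(p, q)]. *)
Lemma not_solvable_of_trivial_germs K p q : subgroup K -> p < q ->
  fixed_by act K p ->
  (forall y, p < y < q -> ~ fixed_by act K y) ->
  (forall k, K k -> exists2 e, p < e & forall y, p < y < e -> act k y = y) ->
  ~ solvable K.
Proof.
move=> sK pq Kp nK triv [n]; elim: n K sK Kp nK triv => [|n IHn] K sK Kp nK triv.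
  rewrite /derived_series /= => K1.
  have [y ypq] : exists y, p < y < q by exists ((p + q) / 2); lra.
  by apply: (nK y ypq) => k; rewrite K1 => ->; exact: (act1 A).
rewrite derived_seriesSr; apply: IHn.
- exact: generated_subgroup.
- by move=> k /(derived_subgroup_sub sK); exact: Kp.
- exact: derived_no_fixed.
- by move=> k /(derived_subgroup_sub sK); exact: triv.
Qed.

(** The derived subgroup is normal, so [K] permutes its fixed points. Concretely, the hypothesis is
    used for the pairs [k, l * m] and [k, m]. *)
Lemma commuting_at_act K x m : subgroup K -> K m ->
  commuting_at act K x -> commuting_at act K (act m x).
Proof.
move=> sK Km cx k l Kk Kl; rewrite -(actM A l m) cx //; last exact: subgroupM.
by rewrite (actM A) -(actM A k m) -cx ?(actM A) //; exact: subgroupM.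
Qed.

Lemma fixed_derived_commuting K x :
  fixed_by act (derived_subgroup K) x -> commuting_at act K x.
Proof.
by move=> fx k l Kk Kl; apply: comm_fix_act; apply: fx; exact: derived_comm.
Qed.

Lemma commuting_at_sup K (S : set R) : S !=set0 -> has_ubound S ->
  (forall x, S x -> commuting_at act K x) -> commuting_at act K (sup S).
Proof.
move=> S0 Sb SK k l Kk Kl.
(* The commutator fixes [S] pointwise; recording this in the set makes its stability immediate. *)
have -> : sup S = sup [set x | S x /\ act [~ k, l]%g x = x].
  congr sup; apply/seteqP; split=> [x Sx|x []//]; split=> //.
  by apply: act_comm_fix; exact: SK.
apply: comm_fix_act; apply: act_sup => [||x [Sx e]|x [Sx e]].
- by have [x Sx] := S0; exists x; split=> //; apply: act_comm_fix; exact: SK.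
- by have [M hM] := Sb; exists M => x [/hM].
- by rewrite e.
- by rewrite act_fixV.
Qed.

(* A fixed point [x] of all commutators could be moved into [(p, r)]; pushing it
   by [g] towards [r] shows that all commutators fix [r], so that [g] fixes the
   whole orbit of [r], which enters [(p, r)]. *)
Lemma derived_no_fixed_of_orbital K g p r q : subgroup K ->
  fixed_by act K p -> (forall y, p < y < q -> ~ fixed_by act K y) ->
  K g -> orbital act g p r -> r < q ->
  forall y, p < y < q -> ~ fixed_by act (derived_subgroup K) y.
Proof.
move=> sK Kp nK Kg [pr gp gr gfree] rq x xpq /fixed_derived_commuting cx.
have [l Kl lx] := orbit_near_left sK Kp nK xpq pr.
pose S := [set z | commuting_at act K z /\ p < z < r].
have S0 : S !=set0 by exists (act l x); split=> //; exact: commuting_at_act.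
have Sb : has_ubound S by exists r => z [_ /andP[_ /ltW]].
have sp : p < sup S.
  have [y Sy] := S0; have [_ /andP[py _]] := Sy.
  by apply: (lt_le_trans py); exact: ub_le_sup.
have sr : sup S <= r by apply: ge_sup => // z [_ /andP[_ /ltW]].
have gS : act g (sup S) = sup S.
  apply: act_sup => // z [cz /andP[pz zr]].
    split; first exact: commuting_at_act.
    by rewrite -{1}gp -{1}gr !act_ltE pz.
  split; first by apply: commuting_at_act => //; exact: subgroupV.
  by rewrite -{1}(act_fixV gp) -{1}(act_fixV gr) !act_ltE pz.
have esr : sup S = r.
  apply/eqP; rewrite eq_le sr leNgt; apply/negP => lsr.
  by apply: (gfree (sup S)) => //; rewrite sp.
have cr : commuting_at act K r.
  by rewrite -esr; apply: commuting_at_sup => // z [].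
have [|m Km mr] := @orbit_near_left K p q r r sK Kp nK _ pr; first by rewrite pr.
by apply: (gfree _ mr); rewrite cr // gr.
Qed.

Lemma right_gap (s : seq R) p :
  exists2 b, p < b & forall x, p < x < b -> x \notin s.
Proof.
elim: s => [|c s [b pb hb]]; first by exists (p + 1) => //; lra.
have [cp|pc] := leP c p.
  exists b => // x /[dup] /hb xs /andP[px _].
  by rewrite inE negb_or xs andbT gt_eqF // (le_lt_trans cp).
exists (Num.min b c); first by rewrite lt_min pb.
move=> x; rewrite lt_min => /and3P[px xb xc].
by rewrite inE negb_or lt_eqF //= hb // px.
Qed.

Lemma affine_right g p : exists2 b, p < b &
  exists m c, forall x, p <= x <= b -> act g x = m * x + c.
Proof.
have [s hs] := act_pl A g; have [b pb hb] := right_gap s p.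
by exists b => //; exact: hs.
Qed.

Lemma germ_right g p : act g p = p -> exists2 b, p < b &
  exists2 m, 0 < m & forall x, p <= x <= b -> act g x = p + m * (x - p).
Proof.
move=> gp; have [b pb [m [c hb]]] := affine_right g p; exists b => //.
have ep : act g p = m * p + c by apply: hb; rewrite lexx ltW.
exists m; last by move=> x /hb ->; lra.
have := act_incr A g pb; rewrite hb ?lexx ?ltW // hb ?lexx ?ltW //.
by rewrite -subr_gt0 (_ : _ - _ = m * (b - p)) ?pmulr_lgt0 ?subr_gt0 //; lra.
Qed.

(** Just to the right of [p] both maps are scalings about [p], and scalings commute. *)
Lemma germs_commute g h p : act g p = p -> act h p = p ->
  exists2 e, p < e & forall x, p <= x <= e ->
    act g (act h x) = act h (act g x).
Proof.
move=> gp hp; have [b pb [m m0 hb]] := germ_right gp.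
have [c pc [n n0 hc]] := germ_right hp.
have gb : p < act g^-1%g c by rewrite -{1}(act_fixV gp) act_ltE.
have gc : p < act h^-1%g b by rewrite -{1}(act_fixV hp) act_ltE.
(* The last two bounds keep [g x] and [h x] where the other map is still given by its scaling. *)
exists (Num.min (Num.min b c) (Num.min (act g^-1%g c) (act h^-1%g b))).
  by rewrite !lt_min pb pc gb gc.
move=> x; rewrite !le_min => /and3P[px /andP[xb xc] /andP[xgc xhb]].
have hx : p <= act h x <= b.
  by rewrite -{1}hp act_leE px /= -(actKV h b) act_leE.
have gx : p <= act g x <= c.
  by rewrite -{1}gp act_leE px /= -(actKV g c) act_leE.
rewrite (hb _ hx) (hc _ gx) hb ?px // hc ?px //; lra.
Qed.

Lemma derived_trivial_germs K p : subgroup K -> fixed_by act K p ->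
  forall k, derived_subgroup K k ->
    exists2 e, p < e & forall y, p < y < e -> act k y = y.
Proof.
move=> sK Kp; apply: derived_sub.
  apply/subgroupP; split=> [|g h [d pd gd] [e pe he]].
    by exists (p + 1) => [|y _]; [lra|exact: (act1 A)].
  exists (Num.min d e) => [|y]; first by rewrite lt_min pd.
  rewrite lt_min => /and3P[py yd ye].
  by rewrite (actM A) act_fixV ?gd ?he // py.
move=> g h Kg Kh; have [e pe he] := germs_commute (Kp g Kg) (Kp h Kh).
by exists e => // y /andP[py ye]; apply: act_comm_fix; rewrite he // !ltW.
Qed.

(** If [r < q], the derived subgroup has trivial germs at [p] but no fixed point in [(p, q)], so it
    is not solvable. *)
Lemma solvable_orbital_left K g p r q : subgroup K -> solvable K ->
  fixed_by act K p -> fixed_by act K q ->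
  (forall y, p < y < q -> ~ fixed_by act K y) ->
  K g -> orbital act g p r -> q <= r.
Proof.
move=> sK solK Kp Kq nK Kg og; rewrite leNgt; apply/negP => rq.
have [pr _ _ _] := og.
have solK' : solvable (derived_subgroup K).
  have [n Kn] := solK; exists n; rewrite -derived_seriesSr.
  rewrite /derived_series iterS -/(derived_series n K) Kn.
  apply/seteqP; split=> [|x ->]; last by apply: subgroup1; exact: generated_subgroup.
  apply: derived_sub => [|x y -> ->]; last by rewrite /commg /conjg !invg1 !mulg1.
  by apply/subgroupP; split=> // x y -> ->; rewrite mulgV.
apply: (@not_solvable_of_trivial_germs (derived_subgroup K) p q) => //.
- exact: generated_subgroup.
- exact: lt_trans rq.
- by move=> k /(derived_subgroup_sub sK); exact: Kp.
- exact: derived_no_fixed_of_orbital og rq.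
- exact: derived_trivial_germs.
Qed.

End Dynamics.

(** * Reflection of orbitals and left ends of support components *)

Section Orbitals.
Variables (G : groupType) (R : realType) (act : G -> R -> R).
Hypothesis A : pl_action act.
Implicit Types (g h k : G) (K H : set G) (x y z p q r a b c d : R).

Lemma mirror_orbital g a b :
  orbital act g a b -> orbital (mirror act) g (- b) (- a).
Proof.
move=> [ab ga gb gf]; rewrite /mirror; split; rewrite ?opprK ?ga ?gb ?ltrN2 //.
by move=> x xba e; apply: (gf (- x)); [lra|apply: oppr_inj; rewrite e opprK].
Qed.

Lemma mirror_fixed_by K x : fixed_by (mirror act) K x <-> fixed_by act K (- x).
Proof.
rewrite /mirror; split=> f k Kk; last by rewrite f ?opprK.
by apply: oppr_inj; rewrite f ?opprK.
Qed.

Lemma solvable_orbital_right K g p r q : subgroup K -> solvable K ->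
  fixed_by act K p -> fixed_by act K q ->
  (forall y, p < y < q -> ~ fixed_by act K y) ->
  K g -> orbital act g r q -> r <= p.
Proof.
move=> sK solK Kp Kq nK Kg og; rewrite -lerN2.
apply: (@solvable_orbital_left _ _ _ (mirror_pl_action A) K g (- q)) => //.
- by apply/mirror_fixed_by; rewrite opprK.
- by apply/mirror_fixed_by; rewrite opprK.
- by move=> y yqp /mirror_fixed_by; apply: nK; lra.
- exact: mirror_orbital.
Qed.

Lemma component_left K z : subgroup K -> ~ fixed_by act K z ->
  exists p, [/\ p < z, fixed_by act K p &
    forall y, p < y <= z -> ~ fixed_by act K y].
Proof.
move=> sK nz; pose S := [set x | x <= z /\ fixed_by act K x].
have S0 : S !=set0.
  (* This point is at most [-1], in the region where the whole group acts trivially. *)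
  exists (Num.min (-1) z); split; first by rewrite ge_min lexx orbT.
  move=> k _; apply: (act_out A); rewrite ltr0_norm.
    by rewrite lerNr ge_min lexx.
  by rewrite gt_min ltrN10.
have Sb : has_ubound S by exists z => x [].
have sz : sup S <= z by apply: ge_sup => // x [].
have fs : fixed_by act K (sup S).
  move=> k Kk; apply: (act_sup A) => // x Sx; have [_ fx] := Sx.
    by rewrite fx.
  by rewrite (act_fixV A (fx _ Kk)).
exists (sup S); split=> //.
  by rewrite lt_neqAle sz andbT; apply/eqP => e; apply: nz; rewrite -e.
move=> y /andP[sy yz] fy; have : y <= sup S by apply: ub_le_sup.
by rewrite leNgt sy.
Qed.

End Orbitals.

(** * Nesting of orbitals under solvability *)

Section Nesting.
Variables (G : groupType) (R : realType) (act : G -> R -> R).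
Hypothesis A : pl_action act.
Implicit Types (g h k : G) (K H : set G) (x y z p q r a b c d : R).

Lemma component K z : subgroup K -> ~ fixed_by act K z ->
  exists p q, [/\ p < z < q, fixed_by act K p, fixed_by act K q &
    forall y, p < y < q -> ~ fixed_by act K y].
Proof.
move=> sK nz; have [p [pz Kp np]] := component_left A sK nz.
have nz' : ~ fixed_by (mirror act) K (- z).
  by move=> /mirror_fixed_by; rewrite opprK.
have [q [qz Kq nq]] := component_left (mirror_pl_action A) sK nz'.
exists p, (- q); split=> //; [by lra|exact/mirror_fixed_by|].
move=> y /andP[py yq]; have [yz|zy] := leP y z; first by apply: np; rewrite py.
move=> fy; apply: (nq (- y)); first by lra.
by apply/mirror_fixed_by; rewrite opprK.
Qed.

Lemma generated_fixed (X : set G) x : (forall g, X g -> act g x = x) ->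
  fixed_by act (generated X) x.
Proof. by move=> Xx; apply: generated_sub => //; exact: stab_subgroup. Qed.

Lemma orbital_exists g z : act g z <> z ->
  exists a b, a < z < b /\ orbital act g a b.
Proof.
move=> gz; have sK := generated_subgroup [set g].
have gg : generated [set g] g by exact: sub_generated.
have [|a [b [zab fa fb nf]]] := component (z := z) sK; first by move=> /(_ _ gg).
exists a, b; split=> //; split; [by lra|exact: fa|exact: fb|].
by move=> x xab gx; apply: (nf _ xab); apply: generated_fixed => _ ->.
Qed.

Lemma orbital_sub g a b p q z : orbital act g a b ->
  act g p = p -> act g q = q -> a < z < b -> p < z < q -> p <= a /\ b <= q.
Proof.
move=> [ab ga gb gf] gp gq zab zpq; split; rewrite leNgt; apply/negP => lt.
  by apply: (gf p) => //; lra.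
by apply: (gf q) => //; lra.
Qed.

Lemma orbital_uniq g a b c d z : orbital act g a b -> orbital act g c d ->
  a < z < b -> c < z < d -> a = c /\ b = d.
Proof.
move=> o1 o2 zab zcd; have [_ ga gb _] := o1; have [_ gc gd _] := o2.
have [ca bd] := orbital_sub o1 gc gd zab zcd.
have [ac db] := orbital_sub o2 ga gb zcd zab.
by split; apply/eqP; rewrite eq_le ?ca ?ac ?bd ?db.
Qed.

Lemma orbital_conj g h a b : orbital act g a b ->
  orbital act (h * g * h^-1)%g (act h a) (act h b).
Proof.
move=> [ab ga gb gf]; split.
- exact: (act_incr A).
- by rewrite !(actM A) (actK A) ga.
- by rewrite !(actM A) (actK A) gb.
move=> x /andP[ax xb] e; apply: (gf (act h^-1%g x)).
  by rewrite -(act_ltE A h) (actKV A) ax -(act_ltE A h) (actKV A).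
by rewrite -[RHS](congr1 (act h^-1%g) e) !(actM A) (actK A).
Qed.

Definition strictly_inside (I J : R * R) := J.1 < I.1 /\ I.2 < J.2.

(* The group generated by [g] and [h] has a component of support [(p, q)]
   containing [z]; one of them has a nontrivial germ at [p], hence an orbital
   starting at [p], which is all of [(p, q)] by solvability. *)
Lemma orbitals_nested g h a b c d z : solvable (generated [set g; h]) ->
  orbital act g a b -> orbital act h c d -> a < z < b -> c < z < d ->
  [\/ (a, b) = (c, d), strictly_inside (a, b) (c, d)
    | strictly_inside (c, d) (a, b)].
Proof.
move=> solK og oh zab zcd; pose K := generated [set g; h].
have sK : subgroup K by exact: generated_subgroup.
have Kg : K g by apply: sub_generated; left.
have Kh : K h by apply: sub_generated; right.
have [|p [q [zpq Kp Kq nK]]] := component (z := z) sK.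
  by move=> /(_ _ Kg); have [_ _ _] := og; apply.
(* If [g1] moves all points just right of [p], its orbital is all of [(p, q)], and the other orbital
   shares both ends with it or neither. The claim is stated for both orders of [g] and [h]. *)
have inner g1 h1 a1 b1 c1 d1 : K g1 -> K h1 ->
    orbital act g1 a1 b1 -> orbital act h1 c1 d1 ->
    a1 < z < b1 -> c1 < z < d1 -> (exists x, p < x < q /\
      forall y, p < y <= x -> act g1 y <> y) ->
    (a1, b1) = (c1, d1) \/ strictly_inside (c1, d1) (a1, b1).
  move=> Kg1 Kh1 o1 o2 z1 z2 [x [xpq gx]].
  have [|r [s [xrs o3]]] := @orbital_exists g1 x; first by apply: gx; lra.
  have [rs gr gs gfree] := o3.
  have [pr _] := orbital_sub o3 (Kp _ Kg1) (Kq _ Kg1) xrs xpq.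
  have erp : r = p.
    apply/eqP; rewrite eq_le pr andbT leNgt; apply/negP => lt.
    by apply: (gx r) => //; lra.
  subst r; have qs := solvable_orbital_left A sK solK Kp Kq nK Kg1 o3.
  have zps : p < z < s by lra.
  have [ea eb] := orbital_uniq o1 o3 z1 zps; subst a1 b1.
  have [_ sq] := orbital_sub o3 (Kp _ Kg1) (Kq _ Kg1) zps zpq.
  have esq : s = q by apply/eqP; rewrite eq_le sq qs.
  subst s; have [pc dq] := orbital_sub o2 (Kp _ Kh1) (Kq _ Kh1) z2 zpq.
  have [epc|npc] := eqVneq p c1.
    subst c1; left; congr (_, _); apply/eqP; rewrite eq_le dq andbT.
    exact: (solvable_orbital_left A sK solK Kp Kq nK Kh1 o2).
  have [edq|ndq] := eqVneq d1 q.
    subst d1; have := solvable_orbital_right A sK solK Kp Kq nK Kh1 o2.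
    by rewrite leNgt lt_neqAle npc pc.
  by right; split; rewrite /= lt_neqAle ?npc ?ndq.
have [e pe [m m0 ge]] := germ_right A (Kp _ Kg).
have [f pf [n n0 hf]] := germ_right A (Kp _ Kh).
have [x [px xe xf xq]] : exists x, [/\ p < x, x < e, x < f & x < q].
  have : p < Num.min (Num.min e f) q by rewrite !lt_min pe pf /=; lra.
  move=> lt; exists ((p + Num.min (Num.min e f) q) / 2).
  set M := Num.min _ _ in lt *.
  have : M <= Num.min e f by rewrite ge_min lexx.
  rewrite le_min => /andP[Me Mf]; have Mq : M <= q by rewrite ge_min lexx orbT.
  by split; lra.
(* A slope other than 1 at [p] moves all points just right of [p]; if both slopes are 1, all of [K]
   fixes [x]. *)
have [em|nm] := eqVneq m 1; last first.
  have [|->|] := inner g h a b c d Kg Kh og oh zab zcd;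
    [|by constructor 1|by constructor 3].
  exists x; split=> [|y /andP[py yx]]; first by rewrite px.
  rewrite ge ?(ltW py) ?(le_trans yx (ltW xe)) // => eqy.
  have : (m - 1) * (y - p) = 0 by lra.
  by move/eqP; rewrite mulf_eq0 !subr_eq0 (negPf nm) gt_eqF.
have [en|nn] := eqVneq n 1; last first.
  have [|->|] := inner h g c d a b Kh Kg oh og zcd zab;
    [|by constructor 1|by constructor 2].
  exists x; split=> [|y /andP[py yx]]; first by rewrite px.
  rewrite hf ?(ltW py) ?(le_trans yx (ltW xf)) // => eqy.
  have : (n - 1) * (y - p) = 0 by lra.
  by move/eqP; rewrite mulf_eq0 !subr_eq0 (negPf nn) gt_eqF.
exfalso; apply: (nK x); first by rewrite px.
apply: generated_fixed => k [->|->].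
  by rewrite ge ?em ?(ltW px) ?(ltW xe) //; lra.
by rewrite hf ?en ?(ltW px) ?(ltW xf) //; lra.
Qed.

End Nesting.

(** Choosing one code per element gives an injection into [B]. An element may have many codes, as
    long as each code determines its element. *)
Lemma countable_coding (T U : Type) (A : set T) (B : set U) (P : T -> U -> Prop) :
  countable B -> (forall a, A a -> exists2 b, B b & P a b) ->
  (forall a a' b, A a -> A a' -> P a b -> P a' b -> a = a') -> countable A.
Proof.
move=> /countable_injP[f finj] AB Pinj; apply/countable_injP.
have /choice[c hc] : forall a, exists n, A a -> exists b, [/\ B b, P a b & f b = n].
  (* Choice needs a total relation: elements outside [A] get the dummy value 0. *)
  move=> a; have [/AB[b Bb Pab]|nA] := pselect (A a); last by exists 0%N.
  by exists (f b) => _; exists b.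
exists c => a a'; rewrite !inE => Aa Aa'.
have [b [Bb Pab <-]] := hc a Aa; have [b' [Bb' Pab' <-]] := hc a' Aa'.
by move=> /finj e; move: Pab; rewrite e ?inE // => Pab; exact: (Pinj a a' b').
Qed.

Lemma rat_between (R : realType) (x y : R) :
  x < y -> exists q : rat, x < ratr q < y.
Proof. by move=> /rat_in_itvoo[q]; rewrite in_itv; exists q. Qed.

(* The set of [z] where the formula fails is stable under the contraction [f],
   so it cannot stay at a positive distance from [a]. *)
Lemma germ_propagates (R : realType) (f k : R -> R) (a d e l s : R) :
  a < d -> 0 < l < 1 -> (forall x, a <= x <= e -> f x = a + l * (x - a)) ->
  (forall x, a <= x <= d -> k x = a + s * (x - a)) ->
  (forall x, a <= x <= e -> f (k x) = k (f x)) ->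
  forall z, a <= z <= e -> a <= k z <= e -> k z = a + s * (z - a).
Proof.
move=> ad /andP[l0 l1] fE kE fk z ze kze; apply: contrapT => nz.
pose S := [set z | [/\ a <= z <= e, a <= k z <= e & k z <> a + s * (z - a)]].
have S0 : S !=set0 by exists z.
have Sd x : S x -> d <= x.
  move=> [/andP[ax _] _ nx]; rewrite leNgt; apply/negP => xd.
  by apply: nx; apply: kE; rewrite ax ltW.
have Sf x : S x -> S (a + l * (x - a)).
  move=> [xe kxe nx]; have fx := fE x xe; have fkx := fk x xe.
  rewrite fx (fE _ kxe) in fkx; split; [by nra|by rewrite -fkx; nra|].
  rewrite -fkx => e1; apply: nx.
  have : l * (k x - (a + s * (x - a))) = 0 by lra.
  by move=> /eqP; rewrite mulf_eq0 (gt_eqF l0) subr_eq0 => /eqP.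
have Sb : has_lbound S by exists d => x /Sd.
have di : d <= inf S by apply: lb_le_inf => // x /Sd.
have : a + (inf S - a) / l <= inf S.
  apply: lb_le_inf => // x /Sf/(ge_inf Sb) ix.
  by rewrite -lerBrDl ler_pdivrMr //; lra.
rewrite -lerBrDl ler_pdivrMr // ; nra.
Qed.

(** * Countability of the orbitals of a locally solvable group *)

Section Counting.
Variables (G : groupType) (R : realType) (act : G -> R -> R).
Hypothesis A : pl_action act.
Implicit Types (g h k f : G) (x y z p q r a b c d : R).

(** Were one point moved up and another down, the supremum of suitable points not moved down would
    be a fixed point inside the orbital, as in Tarski's fixed point theorem. *)
Lemma orbital_sign g a b x y : orbital act g a b -> a < x < b -> x < act g x ->
  a < y < b -> y < act g y.
Proof.
have cross f c d u v : orbital act f c d -> c < u -> v < d -> u < v ->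
    u < act f u -> act f v < v -> False.
  move=> [cd fc fd ff] cu vd uv fu fv; pose S := [set z | z <= v /\ z <= act f z].
  have Su : S u by split; exact: ltW.
  have Sb : has_ubound S by exists v => z [].
  have us : u <= sup S by exact: ub_le_sup.
  have sv : sup S <= v by apply: ge_sup => [|z []]; first by exists u.
  have fs : sup S <= act f (sup S).
    apply: ge_sup => [|z Sz]; first by exists u.
    have [_ zf] := Sz; apply: (le_trans zf); rewrite act_leE //.
    exact: ub_le_sup.
  apply: (ff (sup S)); first by lra.
  apply/eqP; rewrite eq_le fs andbT; apply: ub_le_sup => //; split.
    by apply/ltW/le_lt_trans/fv; rewrite act_leE.
  by rewrite act_leE.
move=> og /andP[ax xb] gx /andP[ay yb].
have [ab ga gb gf] := og; rewrite ltNge le_eqVlt; apply/negP => /orP[/eqP e|gy].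
  by apply: (gf y) => //; rewrite ay.
have [xy|yx|exy] := ltgtP x y; first exact: (cross g a b x y).
  (* For [y < x] the roles are exchanged by the inverse, which moves [y] up and [x] down. *)
  have og' : orbital act g^-1%g a b.
    split; rewrite ?(act_fixV A) // => z zab e; apply: (gf z zab).
    by rewrite -{1}e (actKV A).
  apply: (cross g^-1%g a b y x) => //.
    by rewrite -(act_ltE A g) (actKV A).
  by rewrite -(act_ltE A g) (actKV A).
by move: gx gy; rewrite exy => /ltW; rewrite leNgt => /negP.
Qed.

Variable H : set G.
Hypotheses (sH : subgroup H) (lsH : locally_solvable H).

Definition orbitals : set (R * R) :=
  [set I | exists2 h, H h & orbital act h I.1 I.2].

Lemma orbitals_act h a b : H h -> orbitals (a, b) -> orbitals (act h a, act h b).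
Proof.
move=> Hh [g Hg og]; exists (h * g * h^-1)%g; last exact: (orbital_conj A).
by do ! [apply: subgroupM => // | apply: subgroupV => //].
Qed.

(** Two elements of [H] generate a finitely generated, hence solvable, group, so nesting holds
    throughout [H]. *)
Lemma orbitals_laminar I J z : orbitals I -> orbitals J ->
  I.1 < z < I.2 -> J.1 < z < J.2 ->
  [\/ I = J, strictly_inside I J | strictly_inside J I].
Proof.
case: I J => [a b] [c d] [g Hg og] [h Hh oh]; apply: (orbitals_nested A) og oh.
apply: lsH; first by exists [set g; h] => //; exact: finite_set2.
by apply: generated_sub => // k [->|->].
Qed.

Lemma orbital_up g a b z : H g -> orbital act g a b -> a < z < b ->
  exists2 f, H f & orbital act f a b /\ z < act f z.
Proof.
move=> Hg og zab; have [ab ga gb gf] := og.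
have [zg|gz|/esym/gf] := ltgtP z (act g z); [by exists g| |by []].
exists g^-1%g; first exact: subgroupV.
split; last by rewrite -(act_ltE A g) (actKV A).
split; rewrite ?(act_fixV A) // => x xab e; apply: (gf x xab).
by rewrite -{1}e (actKV A).
Qed.

(* If [g] has orbital [I] and moves [q] up, then [g q] lies in no smaller
   orbital [J] containing [q], since [g J] would meet [J]. *)
Lemma countable_orbitals : countable orbitals.
Proof.
pose P (I : R * R) (qr : rat * rat) :=
  [/\ I.1 < ratr qr.1 < I.2, I.1 < ratr qr.2 < I.2 &
   forall J, orbitals J -> J.1 < ratr qr.1 < J.2 -> strictly_inside J I ->
     ~ J.1 < ratr qr.2 < J.2].
apply: (@countable_coding _ _ _ setT P); first exact: countableP.
  move=> [a b] [g Hg /= og]; have [ab _ _ _] := og.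
  have [q qab] := rat_between ab.
  have [f Hf [of_ qf]] := orbital_up Hg og qab; have [_ fa fb ff] := of_.
  have fqb : act f (ratr q) < b by rewrite -fb act_ltE //; lra.
  have [r rfb] := rat_between fqb.
  exists (q, r) => //; split=> //=; first by lra.
  move=> [c d] /= oJ qJ [/= ac db] rJ.
  have oJ' := orbitals_act Hf oJ.
  have up x : a < x < b -> x < act f x by move=> xab; exact: (orbital_sign of_ qab).
  have fc : c < act f c by apply: up; lra.
  have fd : d < act f d by apply: up; lra.
  (* Both [J] and [f J] contain [f q], but [f] moves both ends of [J] up, so they are neither equal
     nor strictly nested. *)
  case: (orbitals_laminar (z := act f (ratr q)) oJ oJ') => /=; first by lra.
  - by rewrite !act_ltE.
  - by move=> [e _]; move: fc; rewrite -e ltxx.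
  - by move=> [/= e _]; lra.
  - by move=> [/= _ e]; lra.
move=> I J [q r] oI oJ [qI rI nI] [qJ rJ nJ].
have [//|s|s] := orbitals_laminar oI oJ qI qJ.
  by case: (nJ I).
by case: (nI J).
Qed.

Definition endpoints : set R :=
  [set e | exists2 I, orbitals I & e = I.1 \/ e = I.2].

Lemma countable_endpoints : countable endpoints.
Proof.
apply: (@countable_coding _ _ _ (orbitals `*` [set: bool])
   (fun e I => e = if I.2 then I.1.1 else I.1.2)).
- by apply: countableX; [exact: countable_orbitals|exact: countableP].
- by move=> e [I oI [->|->]]; [exists (I, true)|exists (I, false)].
- by move=> e e' I _ _ -> ->.
Qed.

Lemma endpoints_act h e : H h -> endpoints e -> endpoints (act h e).
Proof.
by move=> Hh [[a b] oI [->|->]]; exists (act h a, act h b);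
  [exact: orbitals_act|left|exact: orbitals_act|right].
Qed.

Lemma orbital_endpoints g a b : H g -> orbital act g a b ->
  endpoints a /\ endpoints b.
Proof. by move=> Hg og; split; exists (a, b); [exists g|left|exists g|right]. Qed.

Definition endpoint_free x y := forall e, x <= e <= y -> ~ endpoints e.

(** If [w] were moved, its orbital would have to end between [w] and the fixed point [z]. *)
Lemma endpoint_free_fixed k x y z w : H k -> endpoint_free x y ->
  x <= z <= y -> x <= w <= y -> act k z = z -> act k w = w.
Proof.
move=> Hk free zxy wxy kz; apply: contrapT => /(orbital_exists A)[a [b [wab ok]]].
have [Ea Eb] := orbital_endpoints Hk ok; have [ab _ _ kf] := ok.
have [za|az] := leP z a; first by apply: (free a) => //; lra.
have [bz|zb] := leP b z; first by apply: (free b) => //; lra.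
by apply: (kf z) => //; lra.
Qed.

End Counting.

(** * Rigidity on intervals without endpoints *)

Section Rigidity.
Variables (G : groupType) (R : realType) (act : G -> R -> R).
Hypothesis A : pl_action act.
Implicit Types (g h k f : G) (x y z p q r a b c d : R).
Variable H : set G.
Hypotheses (sH : subgroup H) (lsH : locally_solvable H).

(** The interval from [z] to [f z] is a fundamental domain without endpoints, and [f] permutes the
    endpoints. Instead of covering by translates, the extreme reaches of the endpoint-free stretch
    around [z] are shown to be fixed by [f], hence equal to [a] and [b]. *)
Lemma orbital_endpoint_free f a b x y z : H f -> orbital act f a b ->
  endpoint_free act H x y -> a < z < b -> x <= z -> z < act f z -> act f z <= y ->
  forall e, a < e < b -> ~ endpoints act H e.
Proof.
move=> Hf of_ free zab xz zf fy; have [ab fa fb ff] := of_.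
have up w : a < w < b -> w < act f w by move=> ?; exact: (orbital_sign A of_ zab).
have down w : a < w < b -> act f^-1%g w < w.
  move=> wab; rewrite -(act_ltE A f) (actKV A); exact: up.
have stable w : a < w < b -> a < act f w < b.
  by rewrite -{2}fa -{2}fb !(act_ltE A).
have stableV w : a < w < b -> a < act f^-1%g w < b.
  by rewrite -{2}(act_fixV A fa) -{2}(act_fixV A fb) !(act_ltE A).
have EV e : endpoints act H e -> endpoints act H (act f^-1%g e).
  by apply: endpoints_act => //; exact: subgroupV.
have Ef e : endpoints act H e -> endpoints act H (act f e) by exact: endpoints_act.
pose S := [set w | a < w < b /\ forall e, z <= e <= w -> ~ endpoints act H e].
pose T := [set w | a < w < b /\ forall e, w <= e <= z -> ~ endpoints act H e].
have Sz : S z by split=> // e /andP[ze ez]; apply: free; lra.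
have Tz : T z by split=> // e /andP[ze ez]; apply: free; lra.
have Sb : has_ubound S by exists b => w [/andP[_ /ltW]].
have Ta : has_lbound T by exists a => w [/andP[/ltW]].
have supS : sup S = b.
  have zs : z <= sup S by exact: ub_le_sup.
  have sb : sup S <= b by apply: ge_sup => [|w [/andP[_ /ltW]//]]; exists z.
  apply/eqP; rewrite eq_le sb leNgt; apply/negP => lt.
  apply: (ff (sup S)); first by lra.
  apply: (act_sup A) => // [|w [wab wS]|w [wab wS]]; first by exists z.
    split; first exact: stable.
    move=> e /andP[ze efw] Ee; have [efz|fze] := leP e (act f z).
      by apply: (free e) => //; lra.
    apply: (wS _ _ (EV _ Ee)).
    rewrite -(act_leE A f z) -(act_leE A f _ w) (actKV A) efw andbT.
    exact: ltW.
  split; first exact: stableV.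
  by move=> e /andP[ze ew]; apply: wS; have := down w wab; lra.
have infT : inf T = a.
  have iz : inf T <= z by exact: ge_inf.
  have ai : a <= inf T by apply: lb_le_inf => [|w [/andP[/ltW]//]]; exists z.
  apply/eqP; rewrite eq_le ai andbT leNgt; apply/negP => lt.
  apply: (ff (inf T)); first by lra.
  apply: (act_inf A) => // [|w [wab wT]|w [wab wT]]; first by exists z.
    split; first exact: stable.
    by move=> e /andP[we ez]; apply: wT; have := up w wab; lra.
  split; first exact: stableV.
  move=> e /andP[we ez] Ee; have [fez|zfe] := leP (act f e) z.
    apply: (wT _ _ (Ef _ Ee)).
    by rewrite -(act_leE A f^-1%g) (actK A) we.
  apply: (free (act f e)); last exact: Ef.
  rewrite (le_trans xz (ltW zfe)) /=; apply: le_trans fy.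
  by rewrite (act_leE A).
move=> e /andP[ae eb] Ee; have [ze|ez] := leP z e.
  have [||w [wab wS] ew] := @sup_gt _ S e; [by exists z|by rewrite supS|].
  by apply: (wS e) => //; rewrite ze ltW.
have [||w [wab wT] we] := @inf_lt _ T e; [by exists z|by rewrite infT|].
by apply: (wT e) => //; rewrite !ltW.
Qed.

Lemma orbit_near_right K p q x e : subgroup K -> fixed_by act K q ->
  (forall y, p < y < q -> ~ fixed_by act K y) -> p < x < q -> e < q ->
  exists2 k, K k & e < act k x < q.
Proof.
move=> sK Kq nK xpq eq.
have [||||k Kk] := @orbit_near_left _ _ _ (mirror_pl_action A) K (- q) (- p)
    (- x) (- e) sK.
- by apply/mirror_fixed_by; rewrite opprK.
- by move=> y ypq /mirror_fixed_by; apply: nK; lra.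
- by lra.
- by rewrite ltrN2.
by rewrite /mirror opprK => kx; exists k => //; lra.
Qed.

(** Near [a] the map [f] is a contraction towards [a], so a map commuting with it keeps its germ
    formula up to [e]. The action is a parameter so that the mirrored one gives the statement at
    right ends. *)
Lemma commuting_affine (act' : G -> R -> R) f a b : pl_action act' -> a < b ->
  act' f a = a -> (forall x, a < x < b -> act' f x < x) ->
  exists e, [/\ a < e, e < b & forall k, act' k a = a ->
    (forall x, a <= x <= e -> act' f (act' k x) = act' k (act' f x)) ->
    exists s, forall x, a <= x <= e -> a <= act' k x <= e ->
      act' k x = a + s * (x - a)].
Proof.
move=> A' ab fa down; have [e1 ae1 [l l0 fe1]] := germ_right A' fa.
pose e := Num.min e1 ((a + b) / 2).
have ae : a < e by rewrite lt_min ae1; lra.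
have ee1 : e <= e1 by rewrite ge_min lexx.
have eb : e < b by rewrite gt_min; apply/orP; right; lra.
have l1 : l < 1.
  have := down e; rewrite ae eb fe1 ?(ltW ae) // => /(_ isT) lt.
  by rewrite -subr_gt0 -(@pmulr_lgt0 _ (e - a)); lra.
exists e; split=> // k ka fk; have [d ad [s _ ks]] := germ_right A' ka.
exists s; apply: (@germ_propagates _ (act' f) (act' k) a d e l s) => //.
  by rewrite l0.
by move=> x /andP[ax xe]; apply: fe1; rewrite ax (le_trans xe).
Qed.

(** * The stabilizer of an orbital with no endpoint inside *)

Section MinimalOrbital.
Variables (f : G) (a b : R).
Hypotheses (Hf : H f) (of_ : orbital act f a b)
  (fup : forall x, a < x < b -> x < act f x)
  (free : forall e, a < e < b -> ~ endpoints act H e).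

Let stab := [set k | H k /\ (act k a = a /\ act k b = b)].

Lemma stab_itv_subgroup : subgroup stab.
Proof.
apply/subgroupP; split=> [|g h [Hg [ga gb]] [Hh [ha hb]]].
  by split; [exact: subgroup1|rewrite !(act1 A)].
split; last by rewrite !(actM A) !(act_fixV A).
by apply: subgroupM => //; exact: subgroupV.
Qed.

Lemma stab_fixed_point k z : stab k -> a < z < b -> act k z = z ->
  forall w, a < w < b -> act k w = w.
Proof.
move=> [Hk _] zab kz w wab.
apply: (@endpoint_free_fixed _ _ _ A H k (Num.min z w) (Num.max z w) z) => //.
- move=> e; rewrite ge_min le_max => /andP[e1 e2]; apply: free.
  by case/orP: e1; case/orP: e2; lra.
- by rewrite ge_min le_max lexx.
- by rewrite ge_min le_max lexx !orbT.
Qed.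

(** The commutator is trivial near [a], so it has a fixed point in [(a, b)] and fixes all of it. *)
Lemma stab_commute k l w : stab k -> stab l -> a <= w <= b ->
  act k (act l w) = act l (act k w).
Proof.
move=> sk sl /andP[aw wb]; have [ab _ _ _] := of_.
have [Hk [ka kb]] := sk; have [Hl [la lb]] := sl.
have [->|wa] := eqVneq w a; first by rewrite la ka la.
have [->|wb'] := eqVneq w b; first by rewrite lb kb lb.
have scomm : stab [~ k, l]%g by exact: subgroup_comm stab_itv_subgroup sk sl.
have [e ae kl] := germs_commute A ka la.
pose z := Num.min e ((a + b) / 2).
have ze : z <= e by rewrite ge_min lexx.
have zm : z <= (a + b) / 2 by rewrite ge_min lexx orbT.
have az : a < z by rewrite lt_min ae /=; lra.
apply: (comm_fix_act A); apply: (stab_fixed_point scomm (z := z)).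
- by rewrite az; lra.
- by apply: (act_comm_fix A); apply: kl; rewrite ltW.
- by rewrite !lt_neqAle eq_sym wa wb' aw wb.
Qed.

(** The orbital and its image meet, so they are equal or strictly nested; nesting would put an
    endpoint inside [(a, b)], possibly after applying the inverse of [k]. *)
Lemma stab_of_meet k w : H k -> a < w < b -> a < act k w < b -> stab k.
Proof.
move=> Hk wab kwab; have [ab _ _ _] := of_; split=> //.
have oJ : orbitals act H (a, b) by exists f.
have oJ' := orbitals_act A sH Hk oJ.
have [Ea Eb] := orbital_endpoints Hf of_.
have w' : act k a < act k w < act k b by rewrite !(act_ltE A).
case: (orbitals_laminar A sH lsH oJ oJ' kwab w') => [[<- <-]//|[/= l1 l2]|[/= l1 l2]].
  exfalso; apply: (free (e := act k^-1%g a)).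
    rewrite -(act_ltE A k) (actKV A) l1 /= -(act_ltE A k) (actKV A).
    exact: lt_trans l2.
  by apply: endpoints_act => //; exact: subgroupV.
exfalso; apply: (free (e := act k a)); last exact: endpoints_act.
by rewrite l1; have : act k a < act k b; [rewrite (act_ltE A)|lra].
Qed.

(* Near [a], [k] is [x |-> a + s (x - a)]; near [b] it is [x |-> b + u (x - b)].
   If [k] moves [x0] up by a small amount, conjugating by an element [F] that is
   affine at [x0] and takes it close to [b] gives [s = u]; but [k] moves points
   up, so [s > 1 > u]. *)
Lemma minimal_orbital_rigid : exists x0 d, x0 < d /\
  forall k, H k -> x0 <= act k x0 < d -> forall w, a < w < b -> act k w = w.
Proof.
have [ab fa fb ff] := of_.
have sf : stab f by [].
have [ea [aea eab left]] : exists e, [/\ a < e, e < b & forall k, stab k ->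
    exists s, forall x, a <= x <= e -> a <= act k x <= e ->
      act k x = a + s * (x - a)].
  have down x : a < x < b -> act f^-1%g x < x.
    by move=> xab; rewrite -(act_ltE A f) (actKV A); exact: fup.
  have [e [ae eb left]] := commuting_affine A ab (act_fixV A fa) down.
  exists e; split=> // k sk; apply: left => [|x xe]; first by have [_ []] := sk.
  apply: stab_commute => //; last by lra.
  exact: (subgroupV stab_itv_subgroup).
have [eb [aeb ebb right]] : exists e, [/\ a < e, e < b & forall k, stab k ->
    exists u, forall y, e <= y <= b -> e <= act k y <= b ->
      act k y = b + u * (y - b)].
  have ba : - b < - a by rewrite ltrN2.
  have fb' : mirror act f (- b) = - b by rewrite /mirror opprK fb.
  have down x : - b < x < - a -> mirror act f x < x.
    by move=> xab; rewrite /mirror ltrNl; apply: fup; lra.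
  have [e [be ea' right]] := commuting_affine (mirror_pl_action A) ba fb' down.
  exists (- e); split; [by lra|by lra|] => k sk.
  have [|x xe|u ku] := right k.
  - by have [_ [_ kb]] := sk; rewrite /mirror opprK kb.
  - by rewrite /mirror !opprK; congr (- _); apply: stab_commute => //; lra.
  exists u => y ye kye; have := ku (- y); rewrite /mirror opprK => kuy.
  by apply: oppr_inj; rewrite kuy; lra.
pose x0 := (a + ea) / 2.
have ax0 : a < x0 by rewrite /x0; lra.
have x0ea : x0 < ea by rewrite /x0; lra.
have [F sF /andP[ebF Fb]] : exists2 F, stab F & eb < act F x0 < b.
  apply: (@orbit_near_right stab a b) => //; last by lra.
  - exact: stab_itv_subgroup.
  - by move=> k [_ []].
  - by move=> y yab /(_ f sf); exact: ff.
have [t x0t [m [n Ft]]] := affine_right A F x0.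
pose d := Num.min t ea.
have x0d : x0 < d by rewrite lt_min x0t.
have dt : d <= t by rewrite ge_min lexx.
have dea : d <= ea by rewrite ge_min lexx orbT.
exists x0, d; split=> // k Hk /andP[x0k kd].
have sk : stab k by apply: (stab_of_meet Hk (w := x0)); lra.
have [_ [ka kb]] := sk.
have [kx0E|kx0n] := eqVneq (act k x0) x0.
  by apply: (stab_fixed_point sk _ kx0E); lra.
exfalso.
have ok : orbital act k a b.
  split=> // w wab kw; move/eqP: kx0n; apply.
  by apply: (stab_fixed_point sk wab kw); lra.
have kup x : a < x -> x < b -> x < act k x.
  move=> ax xb; apply: (orbital_sign A ok (x := x0)); rewrite ?ax //; first by lra.
  by rewrite lt_neqAle eq_sym kx0n.
have [s ks] := left k sk; have [u ku] := right k sk.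
(* Up to [x1] the images under [k] stay at most [d], within reach of the affine formulas of [F] and
   of the germ at [a]. *)
pose x1 := act k^-1%g d.
have kx1 : act k x1 = d by exact: (actKV A).
have x01 : x0 < x1 by rewrite -(act_ltE A k) kx1.
clearbody x0 d x1; clear left right.
have kright y : eb < y -> y < b -> act k y = b + u * (y - b).
  move=> ey yb; have kyb : act k y < b by rewrite -{1}kb act_ltE.
  have yk : y < act k y by apply: kup => //; exact: lt_trans ey.
  by apply: ku; rewrite !ltW //; exact: lt_trans yk.
(* The identity [F (k x) = k (F x)] in affine form; its values at [x0] and [x1] then compare the
   slopes [s] and [u]. *)
have slide x : x0 <= x -> x <= x1 ->
    m * (a + s * (x - a)) + n = b + u * (m * x + n - b).
  move=> x0x xx1.
  have ax : a < x by exact: lt_le_trans x0x.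
  have kxd : act k x <= d by rewrite -kx1 act_leE.
  have kxea := le_trans kxd dea.
  have xb : x < b.
    rewrite -(act_ltE A k) kb; exact: le_lt_trans eab.
  have xkx : x < act k x by exact: kup.
  have xd := le_trans (ltW xkx) kxd.
  rewrite -ks ?(ltW ax) ?(le_trans xd) ?kxea ?(ltW (lt_trans ax xkx)) //.
  rewrite -!Ft ?x0x ?(le_trans xd) ?(le_trans kxd) ?(le_trans x0x (ltW xkx)) //.
  rewrite -kright; first by apply: stab_commute => //; rewrite !ltW.
    by apply: (lt_le_trans ebF); rewrite act_leE.
  by have [_ [_ <-]] := sF; rewrite act_ltE.
have s1 : 1 < s.
  have := kup x0 ax0 (lt_trans x0ea eab).
  rewrite ks ?(ltW ax0) ?(ltW x0ea) ?(le_trans (ltW ax0) x0k) //; last first.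
    by rewrite (le_trans (ltW kd)).
  by move=> lt; rewrite -subr_gt0 -(@pmulr_lgt0 _ (x0 - a)); lra.
have u1 : u < 1.
  have := kup (act F x0) (lt_trans aeb ebF) Fb; rewrite kright //.
  by move=> lt; rewrite -subr_gt0 -(@pmulr_lgt0 _ (b - act F x0)); lra.
have F01 : m * x0 + n < m * x1 + n.
  have x1d : x1 <= d.
    rewrite -kx1 ltW // kup // ?(lt_trans ax0) // -(act_ltE A k) kx1 kb.
    exact: le_lt_trans eab.
  rewrite -!Ft ?lexx ?(ltW x0t) ?(ltW x01) ?(le_trans x1d) //.
  by rewrite act_ltE.
have := slide x0 (lexx _) (ltW x01); have := slide x1 (ltW x01) (lexx _).
move=> e1 e0.
have /eqP : (s - u) * ((m * x1 + n) - (m * x0 + n)) = 0 by lra.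
by rewrite mulf_eq0 => /orP[] /eqP; lra.
Qed.

End MinimalOrbital.

(** Either some element moves a point up within [[x, y]], which then lies in a minimal orbital, or
    every element with [x <= k x < y] fixes [x] and hence the whole interval. *)
Lemma endpoint_free_rigid x y : x < y -> endpoint_free act H x y ->
  exists x0 d, x0 < d /\
  forall k, H k -> x0 <= act k x0 < d -> forall w, x <= w <= y -> act k w = w.
Proof.
move=> xy free.
have [[f [z [Hf xz zf fy]]]|none] :=
    pselect (exists f z, [/\ H f, x <= z, z < act f z & act f z <= y]).
  have [|a [b [zab of_]]] := @orbital_exists _ _ _ A f z; first by move=> e; lra.
  have afree := orbital_endpoint_free Hf of_ free zab xz zf fy.
  have fup w : a < w < b -> w < act f w by exact: (orbital_sign A of_ zab).
  have [x0 [d [x0d rig]]] := minimal_orbital_rigid Hf of_ fup afree.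
  exists x0, d; split=> // k Hk /(rig k Hk) kab w wxy; apply: kab.
  have [Ea Eb] := orbital_endpoints Hf of_.
  apply/andP; split; rewrite ltNge; apply/negP => le.
    by apply: (free a) => //; lra.
  by apply: (free b) => //; lra.
exists x, y; split=> // k Hk /andP[xk ky].
have kx : act k x = x.
  apply/eqP; rewrite eq_le xk andbT leNgt; apply/negP => lt.
  by apply: none; exists k, x; split=> //; exact: ltW.
move=> w wxy; apply: (endpoint_free_fixed A Hk free _ wxy kx).
by rewrite lexx ltW.
Qed.

End Rigidity.

Lemma countable_union (T : Type) (A B : set T) :
  countable A -> countable B -> countable (A `|` B).
Proof.
move=> cA cB; have -> : A `|` B = \bigcup_(i in [set: bool]) if i then A else B.
  apply/seteqP; split=> [x [Ax|Bx]|x [[] _]];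
    [by exists true|by exists false|by left|by right].
by apply: bigcup_countable => [|[] _]; first exact: countableP.
Qed.

(** * Broken lines built from countably many lines *)

Section PiecewiseLinearFunctions.
Variables (R : realType) (L : set (R * R)).
Hypothesis countL : countable L.

Definition crossings : set R := [set p | exists l l' : R * R,
  [/\ L l, L l', l <> l' & l.1 * p + l.2 = l'.1 * p + l'.2]].

(** Two distinct lines meet in at most one point, so the pair of lines codes the crossing. *)
Lemma countable_crossings : countable crossings.
Proof.
apply: (@countable_coding _ _ _ (L `*` L)
  (fun p ll => ll.1 <> ll.2 /\ ll.1.1 * p + ll.1.2 = ll.2.1 * p + ll.2.2)).
- exact: countableX.
- by move=> p [l [l' [Ll Ll' nl e]]]; exists (l, l').
move=> p p' [[m c] [m' c']] _ _ /= [nl e] [_ e'].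
have /eqP : (m - m') * (p - p') = 0 by lra.
rewrite mulf_eq0 !subr_eq0 => /orP[/eqP em|/eqP//].
by case: nl; rewrite em; congr (_, _); rewrite em in e; lra.
Qed.

(** The index is the depth of gluing: both halves come from the previous level, matching a recursion
    that splits at one point and keeps the same remaining list on both sides. *)
Fixpoint broken_lines (n : nat) : set (R -> R) :=
  if n is n'.+1 then broken_lines n' `|`
    [set fun x => if x <= t.1.2 then t.1.1 x else t.2 x |
      t in broken_lines n' `*` crossings `*` broken_lines n']
  else [set fun x => l.1 * x + l.2 | l in L].

Lemma countable_broken_lines n : countable (broken_lines n).
Proof.
elim: n => [|n IHn] /=; first exact: sub_countable (card_image_le _ _) countL.
apply: countable_union => //; apply: sub_countable (card_image_le _ _) _.
by apply: countableX => //; apply: countableX => //; exact: countable_crossings.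
Qed.

(* A breakpoint outside [crossings] is not a genuine one and is discarded. *)
Lemma piecewise_broken_line (s : seq R) (a b : R) (f : R -> R) : a < b ->
  (forall u v, a <= u -> u < v -> v <= b ->
    (forall x, u < x < v -> x \notin s) ->
    exists2 l, L l & forall x, u <= x <= v -> f x = l.1 * x + l.2) ->
  exists2 g, broken_lines (size s) g & forall x, a <= x <= b -> f x = g x.
Proof.
elim: s a b => [|p s IHs] a b ab fL.
  have [//|//|//|//|l Ll fl] := fL a b.
  by exists (fun x => l.1 * x + l.2) => //; exists l.
(* On an interval without [p] in its interior, avoiding [s] is enough. *)
have skip u v : a <= u -> u < v -> v <= b -> ~ u < p < v ->
    (forall x, u < x < v -> x \notin s) ->
    exists2 l, L l & forall x, u <= x <= v -> f x = l.1 * x + l.2.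
  move=> au uv vb np gap; apply: fL => // x uxv.
  rewrite inE negb_or gap // andbT; apply/eqP => e; apply: np.
  by rewrite -e.
have [[apb cp]|np] := pselect (a < p < b /\ crossings p).
  have [ap pb] := andP apb.
  have [|g1 L1 fg1] := IHs a p ap.
    by move=> u v au uv vp; apply: skip => //; lra.
  have [|g2 L2 fg2] := IHs p b pb.
    by move=> u v pu uv vb; apply: skip => //; lra.
  exists (fun x => if x <= p then g1 x else g2 x).
    by right; exists (g1, p, g2).
  move=> x /andP[ax xb]; case: leP => [xp|/ltW px].
    by apply: fg1; rewrite ax.
  by apply: fg2; rewrite px.
have [|g Lg fg] := IHs a b ab; last by exists g => //; left.
move=> u v au uv vb gap.
have [upv|] := pselect (u < p < v); last by move=> ?; exact: skip.
have [up pv] := andP upv.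
have pb : p <= b by lra.
have ap : a <= p by lra.
have [||l Ll fl] := skip u p au up pb; [by lra|by move=> x ?; apply: gap; lra|].
have [||l' Ll' fl'] := skip p v ap pv vb; [by lra|by move=> x ?; apply: gap; lra|].
have ell' : l = l'.
  apply: contrapT => nl; apply: np; split; first by lra.
  exists l, l'; split=> //.
  by rewrite -fl ?lexx ?ltW // -fl' ?lexx ?ltW.
exists l => // x /andP[ux xv]; have [xp|/ltW px] := leP x p.
  by apply: fl; rewrite ux.
by rewrite ell'; apply: fl'; rewrite px.
Qed.

End PiecewiseLinearFunctions.

(** * Counting affine pieces and group elements *)

Section CountableGroup.
Variables (G : groupType) (R : realType) (act : G -> R -> R).
Hypothesis A : pl_action act.
Implicit Types (g h k : G) (x y : R).
Variable H : set G.
Hypotheses (sH : subgroup H) (lsH : locally_solvable H).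

Let E := endpoints act H.

Definition affine_pieces : set (R * R) := [set l | exists h u v,
  [/\ H h, u < v & forall x, u <= x <= v -> act h x = l.1 * x + l.2]].

Lemma countable_endpoint_lines : countable
  [set l : R * R | exists e e', [/\ E e, E e', e < e', E (l.1 * e + l.2) &
                                 E (l.1 * e' + l.2)]].
Proof.
apply: (@countable_coding _ _ _ (E `*` E `*` (E `*` E))
  (fun l t => [/\ t.1.1 < t.1.2, l.1 * t.1.1 + l.2 = t.2.1 &
                 l.1 * t.1.2 + l.2 = t.2.2])).
- by do 2 ! apply: countableX; exact: (countable_endpoints A sH lsH).
- by move=> l [e [e' [Ee Ee' ee' El El']]]; exists ((e, e'),
    (l.1 * e + l.2, l.1 * e' + l.2)).
move=> [m c] [m' c'] [[e e'] [u u']] _ _ /= [ee' e1 e2] [_ e1' e2'].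
have /eqP : (m - m') * (e - e') = 0 by lra.
rewrite mulf_eq0 !subr_eq0 (lt_eqF ee') orbF => /eqP em.
by rewrite em in e1 *; congr (_, _); lra.
Qed.

(** A rational between [h x0] and [h d] codes the piece: if [h] and [h'] share it and
    [h x0 <= h' x0], then [h^-1 * h'] moves [x0] into [[x0, d)] and is trivial on [[x, y]] by
    rigidity. *)
Lemma countable_endpoint_free_lines x y : countable
  [set l : R * R | [/\ x < y, endpoint_free act H x y & exists2 h, H h &
     forall z, x <= z <= y -> act h z = l.1 * z + l.2]].
Proof.
have [[xy free]|n] := pselect (x < y /\ endpoint_free act H x y); last first.
  apply: (@countable_coding _ _ _ [set: nat] (fun _ _ => True)) => //.
    by move=> l [xy free _]; case: n.
  by move=> l l' _ [xy free _]; case: n.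
have [x0 [d [x0d rig]]] := endpoint_free_rigid A sH lsH xy free.
apply: (@countable_coding _ _ _ [set: rat] (fun l q => exists h,
  [/\ H h, act h x0 < ratr q < act h d &
    forall z, x <= z <= y -> act h z = l.1 * z + l.2])).
- exact: countableP.
- move=> l [_ _ [h Hh hl]]; have [q hq] := rat_between (act_incr A h x0d).
  by exists q => //; exists h.
have agree h h' q : H h -> H h' -> act h x0 < q < act h d ->
    act h' x0 < q < act h' d -> act h x0 <= act h' x0 ->
    forall z, x <= z <= y -> act h z = act h' z.
  move=> Hh Hh' hq h'q le z zxy.
  have : act (h^-1 * h')%g z = z.
    apply: rig => //; first by apply: subgroupM => //; exact: subgroupV.
    by rewrite (actM A) -(act_leE A h) -(act_ltE A h _ d) !(actKV A) le; lra.
  by rewrite (actM A) => e; rewrite -[in LHS]e (actKV A).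
move=> [m c] [m' c'] q _ _ [h [Hh hq hl]] [h' [Hh' hq' hl']].
have hh' z : x <= z <= y -> act h z = act h' z.
  have [le|/ltW le] := leP (act h x0) (act h' x0); first exact: (agree h h' _ _ _ hq).
  by move=> zxy; symmetry; exact: (agree h' h _ _ _ hq').
have xl : x <= x <= y by rewrite lexx ltW.
have yl : x <= y <= y by rewrite lexx ltW.
have := hh' x xl; have := hh' y yl; rewrite !hl ?hl' //= => e1 e2.
have /eqP : (m - m') * (x - y) = 0 by lra.
rewrite mulf_eq0 !subr_eq0 (lt_eqF xy) orbF => /eqP em.
by rewrite em in e1 *; congr (_, _); lra.
Qed.

Lemma countable_affine_pieces : countable affine_pieces.
Proof.
apply: sub_countable (countable_union countable_endpoint_lines
  (@bigcup_countable (rat * rat) _ [set: rat * rat] _ (countableP _)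
     (fun q _ => countable_endpoint_free_lines (ratr q.1) (ratr q.2)))).
apply: subset_card_le => l [h [u [v [Hh uv hl]]]].
have [[e [e' [[Ee Ee' ee'] [ue e'v]]]]|n] :=
    pselect (exists e e', [/\ E e, E e' & e < e'] /\ u <= e /\ e' <= v).
  have uev : u <= e <= v by lra.
  have ue'v : u <= e' <= v by lra.
  by left; exists e, e'; split=> //; rewrite -hl //; exact: (endpoints_act A sH Hh).
(* There is at most one endpoint in [[u, v]], so an open subinterval avoids it. *)
have [u' [v' [uu' uv' vv' free]]] : exists u' v',
    [/\ u <= u', u' < v', v' <= v & forall e, u' < e < v' -> ~ E e].
  have [[e [Ee ue ev]]|n'] := pselect (exists e, [/\ E e, u < e & e < v]).
    exists u, e; split=> //; [exact: ltW|].
    by move=> e' /andP[ue' e'e] Ee'; apply: n; exists e', e; split=> //; lra.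
  exists u, v; split=> // e /andP[ue ev] Ee.
  by apply: n'; exists e; split.
(* Rational ends make the union countable and keep the closed interval free of endpoints. *)
have [q uq] := rat_between uv'; have [r qr] := rat_between (proj2 (andP uq)).
right; exists (q, r) => //; split=> /=; first by lra.
  by move=> e qer; apply: free; lra.
by exists h => // z zqr; apply: hl; lra.
Qed.

Lemma countable_locally_solvable :
  (forall g h, (forall x, act g x = act h x) -> g = h) -> countable H.
Proof.
move=> faithful; pose C n := broken_lines affine_pieces n.
apply: (@countable_coding _ _ _ (\bigcup_(n in [set: nat]) C n)
  (fun h f => forall x, -1 <= x <= 1 -> act h x = f x)).
- apply: bigcup_countable => [|n _]; first exact: countableP.
  by apply: countable_broken_lines; exact: countable_affine_pieces.
- move=> h Hh; have [s hs] := act_pl A h.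
  have [|u v _ uv _ gap|f Cf hf] :=
    @piecewise_broken_line R affine_pieces s (-1) 1 (act h).
  + by lra.
  + have [m [c hmc]] := hs u v uv gap.
    by exists (m, c) => //; exists h, u, v.
  + by exists f => //; exists (size s).
move=> g h f _ _ gf hf; apply: faithful => x.
have [x1|x1] := leP 1 `|x|; first by rewrite !(act_out A).
by rewrite gf ?hf // -ler_norml ltW.
Qed.

End CountableGroup.

(** * The action of [PLo] on the real line *)

Section NaturalAction.
Variable R : realType.
Implicit Types (f g : PLo R) (x : R) (u : @unit_itv R).

Definition PLo_act f x : R := if 0 <= x <= 1 then ext f x else x.

Lemma PLo_actE f u : PLo_act f (val u) = val (f u).
Proof. by rewrite /PLo_act unit_itvP extE. Qed.

Lemma PLo_act_cases x : (exists u, x = val u) \/ (forall f, PLo_act f x = x).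
Proof.
have [x01|x01] := boolP (0 <= x <= 1); last first.
  by right=> f; rewrite /PLo_act (negPf x01).
by have [u <-] := to_unit_itv x01; left; exists u.
Qed.

Lemma PLo_actM f g x : PLo_act (f * g)%g x = PLo_act f (PLo_act g x).
Proof.
by have [[u ->]|out] := PLo_act_cases x; [rewrite !PLo_actE|rewrite !out].
Qed.

Lemma PLo_act_incr f x y : x < y -> PLo_act f x < PLo_act f y.
Proof.
rewrite /PLo_act => xy.
have bnd z : 0 <= z <= 1 -> 0 <= ext f z <= 1.
  by move=> /to_unit_itv[u <-]; rewrite extE unit_itvP.
case: ifPn => x01; case: ifPn => y01.
- have [u eu] := to_unit_itv x01; have [v ev] := to_unit_itv y01.
  by subst x y; rewrite !extE; exact: (PLo_incr f).
- have := bnd x x01; move: y01; rewrite negb_and -!ltNge => /orP[]; lra.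
- have := bnd y y01; move: x01; rewrite negb_and -!ltNge => /orP[]; lra.
- by [].
Qed.

(** Applying [f] to the inequality between 0 and the preimage of 0 bounds [f 0] above by 0. *)
Lemma PLo_act0 f : PLo_act f 0 = 0.
Proof.
have [u u0] : exists u : @unit_itv R, val u = 0 by apply: to_unit_itv; lra.
have := unit_itvP (f u); have := unit_itvP (f^-1%g u).
have fV : f (f^-1%g u) = u by exact: (congr1 (fun k : PLo R => k u) (mulgV f)).
have := orientation_le (PLo_incr f) u (f^-1%g u).
by rewrite fV u0 -u0 PLo_actE u0 => le /andP[]; rewrite le; lra.
Qed.

Lemma PLo_act1 f : PLo_act f 1 = 1.
Proof.
have [u u1] : exists u : @unit_itv R, val u = 1 by apply: to_unit_itv; lra.
have := unit_itvP (f u); have := unit_itvP (f^-1%g u).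
have fV : f (f^-1%g u) = u by exact: (congr1 (fun k : PLo R => k u) (mulgV f)).
have := orientation_le (PLo_incr f) (f^-1%g u) u.
by rewrite fV u1 -u1 PLo_actE u1 => le /andP[_]; rewrite le; lra.
Qed.

Lemma PLo_pl_action : pl_action PLo_act.
Proof.
split.
- by move=> x; have [[u ->]|out] := PLo_act_cases x; [rewrite PLo_actE|exact: out].
- exact: PLo_actM.
- exact: PLo_act_incr.
- move=> f x; have [->|x1] := eqVneq x 1; first by rewrite PLo_act1.
  rewrite /PLo_act ler_normr => le; case: ifPn => // x01.
  by case/orP: le => le; [case/eqP: x1|]; lra.
move=> f; have [/finite_seqP[s bs] fs] := PLo_pl f.
(* The extension by the identity may break at 0 and 1; with these two added, each gap lies left of,
   inside or right of the unit interval. *)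
exists [:: 0, 1 & s] => a b ab gap.
have id_piece : (forall x, a <= x <= b -> PLo_act f x = x) ->
    exists m c, forall x, a <= x <= b -> PLo_act f x = m * x + c.
  by move=> fx; exists 1, 0 => x /fx ->; rewrite mul1r addr0.
have [b0|b0] := leP b 0.
  apply: id_piece => x /andP[_ xb]; have [->|x0] := eqVneq x 0; first exact: PLo_act0.
  rewrite /PLo_act; case: ifPn => // x01; by case/eqP: x0; lra.
have [a1|a1] := leP 1 a.
  apply: id_piece => x /andP[ax _]; have [->|x1] := eqVneq x 1; first exact: PLo_act1.
  rewrite /PLo_act; case: ifPn => // x01; by case/eqP: x1; lra.
have a0 : 0 <= a.
  rewrite leNgt; apply/negP => a0; have := gap 0.
  by rewrite a0 b0 !inE eqxx => /(_ isT).
have b1 : b <= 1.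
  rewrite leNgt; apply/negP => b1; have := gap 1.
  by rewrite a1 b1 !inE eqxx orbT => /(_ isT).
have [|m [c fmc]] := fs a b a0 ab b1.
  by move=> x /gap; rewrite bs !inE !negb_or => /and3P[_ _ /negP].
exists m, c => x xab; have [u ux] : exists u : @unit_itv R, val u = x.
  by apply: to_unit_itv; lra.
by rewrite -ux PLo_actE fmc // ux.
Qed.

Lemma PLo_act_faithful f g : (forall x, PLo_act f x = PLo_act g x) -> f = g.
Proof. by move=> fg; apply: PLo_ext => u; apply: val_inj; rewrite -!PLo_actE. Qed.

End NaturalAction.

Theorem theorem1p1 (R : realType) (H : set (PLo R)) :
  subgroup H -> locally_solvable H -> countable H.
Proof.
move=> sH lsH; apply: (countable_locally_solvable (PLo_pl_action R) sH lsH).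
exact: PLo_act_faithful.
Qed.
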